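(* Let $W$ be a graphon and let $H$ be a non-empty (i.e. having at least one edge) finite simple bipartite graph with $t(H,W)>0$. Define $$\sigma^2_{H,W}:=\frac{1}{2|\mathrm{Aut}(H)|^2}\sum_{(a,b),(c,d)\in E^+(H)}\left[t\Big(H\ominus_{(a,b),(c,d)}H,\,W\Big)-t\Big(H\oplus_{(a,b),(c,d)}H,\,W\Big)\right].$$ Then $\sigma^2_{H,W}=0$ if and only if $W$ is random-free, that is, $W(x,y)\in\{0,1\}$ for a.e. $(x,y)\in[0,1]^2$.
   Context: A graphon is a measurable symmetric function $W:[0,1]^2\to[0,1]$. For a finite loopless multigraph $F$, $t(F,W)=\int_{[0,1]^{|V(F)|}}\prod_{(a,b)\in E(F)}W(x_a,x_b)\prod_adx_a$, edges taken with multiplicity. $\mathrm{Aut}(H)$ is the automorphism group of $H$. $E^+(H)$ is the set of ordered pairs $(a,b)$ of adjacent vertices of $H$. For $(a,b),(c,d)\in E^+(H)$, take two disjoint copies of $H$, identify vertex $a$ of the first with vertex $c$ of the second and vertex $b$ of the first with vertex $d$ of the second; the weak edge join $H\ominus_{(a,b),(c,d)}H$ keeps a single edge between the two identified vertices, and the strong edge join $H\oplus_{(a,b),(c,d)}H$ keeps both edges (a double edge, giving a multigraph). *)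

(* Defs.v *)
From HB Require Import structures.
From mathcomp Require Import all_boot all_order all_algebra all_fingroup.
From mathcomp Require Import all_classical all_reals all_analysis.
Set Implicit Arguments.
Unset Strict Implicit.
Unset Printing Implicit Defensive.
Import Order.TTheory GRing.Theory Num.Theory.
Local Open Scope classical_set_scope.
Local Open Scope ring_scope.

(* Powers mu^n of a sigma-finite measure, on the product sigma-algebra of
   n.-tuple T: mu^0 is the unit mass at the empty tuple and mu^(n+1) is the
   image of mu \x mu^n under (t, s) |-> t :: s. *)

Section cons_measure.
Context d (T : measurableType d) (R : realType).
Variables (mu : {sigma_finite_measure set T -> \bar R}) (n : nat).
Variable nu : {sigma_finite_measure set (n.-tuple T) -> \bar R}.

Definition tuple_cons (p : T * n.-tuple T) : n.+1.-tuple T :=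
  [the n.+1.-tuple T of p.1 :: p.2].

Lemma measurable_tuple_cons : measurable_fun [set: T * n.-tuple T] tuple_cons.
Proof. exact: measurable_cons. Qed.

Definition cons_measure : set (n.+1.-tuple T) -> \bar R :=
  pushforward (mu \x nu)%E tuple_cons.

Let cons_measure0 : cons_measure set0 = 0%E.
Proof. by rewrite /cons_measure /pushforward preimage_set0 measure0. Qed.

Let cons_measure_ge0 A : (0 <= cons_measure A)%E.
Proof. by rewrite /cons_measure /pushforward; exact: measure_ge0. Qed.

Let cons_measure_sigma_additive : semi_sigma_additive cons_measure.
Proof.
move=> F mF tF mUF; rewrite /cons_measure /pushforward preimage_bigcup.
have mcons A : measurable A -> measurable (tuple_cons @^-1` A).
  by move=> mA; rewrite -[X in measurable X]setTI; exact: measurable_tuple_cons.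
apply: measure_semi_sigma_additive.
- by move=> i; exact: mcons.
- apply/trivIsetP => /= i j _ _ ij; rewrite -preimage_setI.
  by move/trivIsetP : tF => /(_ _ _ _ _ ij) ->//; rewrite preimage_set0.
- by rewrite -preimage_bigcup; exact: mcons.
Qed.

HB.instance Definition _ := isMeasure.Build _ _ _ cons_measure
  cons_measure0 cons_measure_ge0 cons_measure_sigma_additive.

Let cons_measure_sigma_finite : sigma_finite setT cons_measure.
Proof.
have /sigma_finiteP[F [TF ndF Foo]] := sigma_finiteT mu.
have /sigma_finiteP[G [TG ndG Goo]] := sigma_finiteT nu.
pose u (s : n.+1.-tuple T) : T * n.-tuple T := (thead s, [tuple of behead s]).
have mu_ : measurable_fun setT u.
  apply: measurable_fun_pair; first exact: measurable_tnth.
  exact: measurable_behead.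
have uK : cancel tuple_cons u.
  by move=> [t s]; congr pair; apply/val_inj.
have mFG k : measurable (F k `*` G k).
  by apply: measurableX; [exact: (Foo k).1|exact: (Goo k).1].
exists (fun k => u @^-1` (F k `*` G k)).
  rewrite -preimage_bigcup (_ : \bigcup_k _ = setT) ?preimage_setT//.
  rewrite -setXTT TF TG predeqE => -[x y]; split.
    by move=> [k _ [/= ? ?]]; split; exists k.
  move=> [/= [k _ Fkx] [l _ Gly]]; exists (maxn k l) => //; split.
  - by move: x Fkx; exact/subsetPset/ndF/leq_maxl.
  - by move: y Gly; exact/subsetPset/ndG/leq_maxr.
move=> k; have [? ?] := Foo k; have [? ?] := Goo k; split.
  by rewrite -[X in measurable X]setTI; exact: mu_.
rewrite /cons_measure /pushforward.
have -> : tuple_cons @^-1` (u @^-1` (F k `*` G k)) = F k `*` G k.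
  by rewrite -comp_preimage (_ : u \o tuple_cons = id) ?preimage_id//; exact/funext/uK.
by rewrite product_measure1E// lte_mul_pinfty// ge0_fin_numE.
Qed.

HB.instance Definition _ := Measure_isSigmaFinite.Build _ _ _ cons_measure
  cons_measure_sigma_finite.

End cons_measure.

Fixpoint power_measure d (T : measurableType d) (R : realType)
    (mu : {sigma_finite_measure set T -> \bar R}) (n : nat) :
    {sigma_finite_measure set (n.-tuple T) -> \bar R} :=
  match n with
  | 0 => \d_ [tuple]
  | n'.+1 => cons_measure mu (power_measure mu n')
  end.

Definition lebesgue_power (R : realType) (n : nat) :=
  power_measure (@lebesgue_measure R) n.

Definition unit_cube (R : realType) (n : nat) : set (n.-tuple R) :=
  [set x | forall i, tnth x i \in `[0, 1]].
Arguments unit_cube : clear implicits.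

Definition unit_square (R : realType) : set (R * R) := `[0, 1] `*` `[0, 1].
Arguments unit_square : clear implicits.

(* Only the values of W on the unit square are relevant. *)
Definition graphon (R : realType) (W : R -> R -> R) : Prop :=
  [/\ measurable_fun (unit_square R) (fun p : R * R => W p.1 p.2),
      {in `[0, 1] &, forall x y, W x y = W y x} &
      {in `[0, 1] &, forall x y, W x y \in `[0, 1]}].

Definition random_free (R : realType) (W : R -> R -> R) : Prop :=
  {ae (@lebesgue_measure R \x @lebesgue_measure R)%E,
    forall p, unit_square R p -> W p.1 p.2 = 0 \/ W p.1 p.2 = 1}.

(* [mult F a b] is the number of parallel edges joining a and b. *)
Record multigraph (V : finType) := Multigraph {
  mult : V -> V -> nat;
  mult_sym : forall a b, mult a b = mult b a;
  mult_loopless : forall a, mult a a = 0%N }.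

Record sgraph (V : finType) := SGraph {
  adj :> rel V;
  adj_sym : symmetric adj;
  adj_irrefl : irreflexive adj }.

Definition sgraph_mult (V : finType) (H : sgraph V) (a b : V) : nat := adj H a b.

Lemma sgraph_mult_sym (V : finType) (H : sgraph V) a b :
  sgraph_mult H a b = sgraph_mult H b a.
Proof. by rewrite /sgraph_mult (adj_sym H). Qed.

Lemma sgraph_mult_loopless (V : finType) (H : sgraph V) a :
  sgraph_mult H a a = 0%N.
Proof. by rewrite /sgraph_mult (adj_irrefl H). Qed.

Definition multigraph_of_sgraph (V : finType) (H : sgraph V) : multigraph V :=
  Multigraph (sgraph_mult_sym H) (sgraph_mult_loopless H).

Coercion multigraph_of_sgraph : sgraph >-> multigraph.

Definition bipartite (V : finType) (H : sgraph V) : Prop :=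
  exists A : {set V}, forall a b, H a b -> (a \in A) != (b \in A).

Definition graph_aut (V : finType) (H : sgraph V) : {set {perm V}} :=
  [set s : {perm V} | [forall a, forall b, H (s a) (s b) == H a b]]%SET.

(* The set E^+(H) of ordered pairs of adjacent vertices. *)
Definition oedge (V : finType) (H : sgraph V) := {p : V * V | H p.1 p.2}.

(* The rank condition selects each unordered pair {a, b} exactly once; for
   symmetric W the orientation chosen is immaterial. *)
Definition hom_density (R : realType) (V : finType) (F : multigraph V)
    (W : R -> R -> R) : R :=
  \int[lebesgue_power R #|V|]_(x in unit_cube R #|V|)
    \prod_(p : V * V | (enum_rank p.1 < enum_rank p.2)%N)
      W (tnth x (enum_rank p.1)) (tnth x (enum_rank p.2)) ^+ mult F p.1 p.2.

Section edge_join.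
Context (V : finType) (H : sgraph V).
Variables e f : oedge H.
Let a := (val e).1.
Let b := (val e).2.
Let c := (val f).1.
Let d := (val f).2.

(* With e = (a, b) and f = (c, d), the vertices of the glued graph are those
   of the first copy of H together with those of the second copy other than
   c and d, which are sent to a and b of the first copy. *)
Definition join_vertex : finType :=
  (V + {v : V | (v != c) && (v != d)})%type.

Definition join_inl (v : V) : join_vertex := inl v.

Definition join_inr (v : V) : join_vertex :=
  if insub v is Some w then inr w else if v == c then inl a else inl b.

Definition image_edge (i : V -> join_vertex) : rel join_vertex :=
  [rel p q | [exists u, exists v, [&& H u v, i u == p & i v == q]]].

Lemma image_edge_sym i : symmetric (image_edge i).
Proof.
move=> p q; apply/existsP/existsP => -[u /existsP[v /and3P[uv iu iv]]];
  by exists v; apply/existsP; exists u; rewrite adj_sym uv iu iv.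
Qed.

Lemma image_edge_irrefl i : injective i -> irreflexive (image_edge i).
Proof.
move=> inji p; apply/existsP => -[u /existsP[v /and3P[uv /eqP iu /eqP iv]]].
by move: uv; rewrite (inji u v) ?adj_irrefl// iu iv.
Qed.

Lemma join_inl_inj : injective join_inl.
Proof. by move=> u v []. Qed.

Lemma join_inr_inj : injective join_inr.
Proof.
have ab : a != b.
  by apply/eqP => ab; move: (valP e); rewrite -/a -/b ab adj_irrefl.
move=> u v; rewrite /join_inr.
case: insubP => [w _ wu|]; case: insubP => [w' _ wv|].
- by move=> [ww']; rewrite -wu ww' wv.
- by move=> _; case: ifP.
- by move=> _; case: ifP.
rewrite !negb_and !negbK.
have [->|vc] /= := eqVneq v c; have [->|uc] //= := eqVneq u c.
- by move=> _ _ [ba]; rewrite ba eqxx in ab.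
- by move=> _ _ [ba]; rewrite ba eqxx in ab.
- by move=> /eqP -> /eqP ->.
Qed.

Definition join_weak_rel : rel join_vertex :=
  [rel p q | image_edge join_inl p q || image_edge join_inr p q].

Definition join_strong_mult (p q : join_vertex) : nat :=
  (image_edge join_inl p q + image_edge join_inr p q)%N.

Lemma join_weak_sym : symmetric join_weak_rel.
Proof. by move=> p q; congr (_ || _); exact: image_edge_sym. Qed.

Lemma join_weak_irrefl : irreflexive join_weak_rel.
Proof.
move=> p; apply/norP; split; apply/negbT; apply: image_edge_irrefl.
- exact: join_inl_inj.
- exact: join_inr_inj.
Qed.

Lemma join_strong_sym p q : join_strong_mult p q = join_strong_mult q p.
Proof. by congr (nat_of_bool _ + nat_of_bool _)%N; exact: image_edge_sym. Qed.

Lemma join_strong_loopless p : join_strong_mult p p = 0%N.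
Proof.
rewrite /join_strong_mult !image_edge_irrefl//.
- exact: join_inr_inj.
- exact: join_inl_inj.
Qed.

Definition weak_join : sgraph join_vertex :=
  SGraph join_weak_sym join_weak_irrefl.

Definition strong_join : multigraph join_vertex :=
  Multigraph join_strong_sym join_strong_loopless.

End edge_join.

Definition sigma2 (R : realType) (V : finType) (H : sgraph V)
    (W : R -> R -> R) : R :=
  (2 * #|graph_aut H|%:R ^+ 2)^-1 *
  \sum_(e : oedge H) \sum_(f : oedge H)
    (hom_density (weak_join e f) W - hom_density (strong_join e f) W).

(* Main.v *)
(* The weak and the strong join have the same pairs of adjacent vertices, and
   the multiplicities of the strong one are at least those of the weak one. So
   every summand of sigma^2 is nonnegative, and it vanishes when W is 0-1 valued
   almost everywhere. Conversely, sigma^2 = 0 forces the summand for the join of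
   H with itself along one edge (a, b) to vanish. Its integrand is positive
   wherever all the edges of the join are mapped into E = {0 < W < 1}. Since the
   join is bipartite, this happens with positive measure unless E is null. *)
Require Import Defs.
From HB Require Import structures.
From mathcomp Require Import all_boot all_order all_algebra all_fingroup.
From mathcomp Require Import all_classical all_reals all_analysis.
From mathcomp Require Import measurable_realfun.
Set Implicit Arguments.
Unset Strict Implicit.
Unset Printing Implicit Defensive.
Import Order.TTheory GRing.Theory Num.Theory.
Local Open Scope classical_set_scope.
Local Open Scope ring_scope.

(** * Null sets of a product measure and their sections *)

Section null_sections.
Context d1 d2 (T1 : measurableType d1) (T2 : measurableType d2) (R : realType).
Variable m1 : {sigma_finite_measure set T1 -> \bar R}.
Variable m2 : {sigma_finite_measure set T2 -> \bar R}.
Variable A : set (T1 * T2).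
Hypothesis mA : measurable A.

Lemma null_xsectionP :
  (m1 \x m2)%E A = 0%E <-> \forall x \ae m1, m2 (xsection A x) = 0%E.
Proof.
have := ae_eq_integral_abs m1 measurableT (measurable_fun_xsection m2 mA).
rewrite /product_measure1; under eq_integral do rewrite gee0_abs//.
move=> ->; split; first by apply: filterS => x; exact.
by apply: filterS => x + _.
Qed.

(** By uniqueness, the product measure is also the integral of the measures of the sections in the
    second variable. *)
Lemma null_ysectionP :
  (m1 \x m2)%E A = 0%E <-> \forall y \ae m2, m1 (ysection A y) = 0%E.
Proof.
rewrite (product_measure_unique (@product_measure2E _ _ _ _ _ m1 m2) mA).
have := ae_eq_integral_abs m2 measurableT (measurable_fun_ysection m1 mA).
rewrite /product_measure2; under eq_integral do rewrite gee0_abs//.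
move=> ->; split; first by apply: filterS => x; exact.
by apply: filterS => x + _.
Qed.

End null_sections.

Lemma measurable_preimageT d1 d2 (T1 : measurableType d1)
    (T2 : measurableType d2) (f : T1 -> T2) (A : set T2) :
  measurable_fun setT f -> measurable A -> measurable (f @^-1` A).
Proof. by move=> mf mA; rewrite -[X in measurable X]setTI; exact: mf. Qed.

Lemma null_aeP d (T : measurableType d) (R : realType)
    (m : {measure set T -> \bar R}) (A : set T) : measurable A ->
  m A = 0%E <-> \forall x \ae m, ~ A x.
Proof.
move=> mA; rewrite -(negligibleP _ mA) -[X in m.-negligible X]setCK.
exact: iff_refl.
Qed.

(* If A is not null, then by Tonelli neither is the set of those (t, (x, z))
   for which both (x, z) and (t, z) lie in A, since its fibre over z is the
   square of the fibre of A. *)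
Section null_duplicate.
Context d1 d2 (T1 : measurableType d1) (T2 : measurableType d2) (R : realType).
Variable m1 : {sigma_finite_measure set T1 -> \bar R}.
Variable m2 : {sigma_finite_measure set T2 -> \bar R}.
Variable A : set (T1 * T2).
Hypothesis mA : measurable A.

Lemma null_duplicate1 :
  (\forall t \ae m1, (m1 \x m2)%E [set p | A p /\ A (t, p.2)] = 0%E) ->
  (m1 \x m2)%E A = 0%E.
Proof.
move=> Anull.
(* [B] is the part of [A] lying over the points with non-null fibre. It is shown to be null, which
   forces almost all fibres of [A] to be null. *)
pose Z := [set z | m1 (ysection A z) != 0%E].
pose B := A `&` snd @^-1` Z.
have mB : measurable B.
  apply: measurableI => //; apply: measurable_preimageT => //.
  rewrite -[X in measurable X]setTI; apply: emeasurable_neq => //.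
  exact: measurable_fun_ysection.
apply/(null_ysectionP _ _ mA).
have /(null_ysectionP _ _ mB) : (m1 \x m2)%E B = 0%E.
  apply/(null_xsectionP _ _ mB); move: Anull; apply: filterS => t.
  have mAt : measurable [set p | A p /\ A (t, p.2)].
    apply: measurableI => //.
    apply: (measurable_preimageT (f := fun p => (t, p.2))) => //.
    exact: measurable_fun_pair.
  move=> /(null_ysectionP _ _ mAt) At0; apply/null_aeP.
    exact: measurable_xsection.
  (* Once (t, z) lies in [A], the condition [A (t, p.2)] holds on the whole fibre over z, which is
     thus the fibre of [A] itself. *)
  move: At0; apply: filterS => z Atz /xsectionP[Atz' /= /eqP]; apply.
  rewrite -Atz !ysectionE; congr (m1 _); apply/seteqP; split => // x.
  by case.
apply: filterS => z.
have [//|Az0] := eqVneq (m1 (ysection A z)) 0%E.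
by move=> <-; rewrite !ysectionE; congr (m1 _); apply/seteqP; split => // x [].
Qed.

Lemma null_duplicate2 :
  (\forall t \ae m2, (m1 \x m2)%E [set p | A p /\ A (p.1, t)] = 0%E) ->
  (m1 \x m2)%E A = 0%E.
Proof.
move=> Anull.
(* The same argument with the two coordinates exchanged. *)
pose Z := [set x | m2 (xsection A x) != 0%E].
pose B := A `&` fst @^-1` Z.
have mB : measurable B.
  apply: measurableI => //; apply: measurable_preimageT => //.
  rewrite -[X in measurable X]setTI; apply: emeasurable_neq => //.
  exact: measurable_fun_xsection.
apply/(null_xsectionP _ _ mA).
have /(null_xsectionP _ _ mB) : (m1 \x m2)%E B = 0%E.
  apply/(null_ysectionP _ _ mB); move: Anull; apply: filterS => t.
  have mAt : measurable [set p | A p /\ A (p.1, t)].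
    apply: measurableI => //.
    apply: (measurable_preimageT (f := fun p => (p.1, t))) => //.
    exact: measurable_fun_pair.
  move=> /(null_xsectionP _ _ mAt) At0; apply/null_aeP.
    exact: measurable_ysection.
  move: At0; apply: filterS => x Atx /ysectionP[Atx' /= /eqP]; apply.
  rewrite -Atx !xsectionE; congr (m2 _); apply/seteqP; split => // y.
  by case.
apply: filterS => x.
have [//|Ax0] := eqVneq (m2 (xsection A x)) 0%E.
by move=> <-; rewrite !xsectionE; congr (m2 _); apply/seteqP; split => // y [].
Qed.
End null_duplicate.

(** * Null sets of power measures *)

Section power_null.
Context d (T : measurableType d) (R : realType).
Variable mu : {sigma_finite_measure set T -> \bar R}.

Lemma power_measureS n (A : set (n.+1.-tuple T)) :
  power_measure mu n.+1 A =
  (mu \x power_measure mu n)%E ((@tuple_cons _ T n) @^-1` A).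
Proof. by []. Qed.

Lemma power_null_consP n (A : set (n.+1.-tuple T)) : measurable A ->
  power_measure mu n.+1 A = 0%E <->
  \forall t \ae mu, power_measure mu n [set s | A (tuple_cons (t, s))] = 0%E.
Proof.
move=> mA; rewrite power_measureS.
have mcA := measurable_preimageT (@measurable_tuple_cons _ T n) mA.
apply: (iff_trans (null_xsectionP _ _ mcA)).
by split; apply: filterS => t; rewrite xsectionE.
Qed.

Lemma measurable_cons_section n (A : set (n.+1.-tuple T)) t : measurable A ->
  measurable [set s | A (tuple_cons (t, s))].
Proof.
move=> mA.
apply: (measurable_preimageT (f := fun s => tuple_cons (t, s))) => //.
apply: measurableT_comp; first exact: measurable_tuple_cons.
exact: measurable_fun_pair.
Qed.

Lemma null_tnth n (i : 'I_n) (A : set T) : measurable A -> mu A = 0%E ->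
  power_measure mu n [set s | A (tnth s i)] = 0%E.
Proof.
move=> mA A0; elim: n i => [[]//|n IH i].
apply/power_null_consP.
  by apply: measurable_preimageT => //; exact: measurable_tnth.
have [j ->|->] := unliftP ord0 i.
  apply: aeW => t; rewrite -[RHS](IH j); congr (power_measure mu n _).
  by apply/seteqP; split => s /=; rewrite tnthS.
have /(null_aeP _ mA) := A0; apply: filterS => t nAt.
rewrite (_ : [set s | _] = set0) ?measure0//; by apply/seteqP; split.
Qed.

(** Induction on n. If i is the first coordinate, fixing it to t leaves the condition that the other
    coordinate lies in the section of [A] at t, which is null for almost every t. *)
Lemma null_tnth_pair n (i j : 'I_n) (A : set (T * T)) : (i < j)%N ->
  measurable A -> (mu \x mu)%E A = 0%E ->
  power_measure mu n [set s | A (tnth s i, tnth s j)] = 0%E.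
Proof.
move=> + mA A0; elim: n i j => [[]//|n IH i j ij].
apply/power_null_consP.
  apply: (measurable_preimageT (f := fun s => (tnth s i, tnth s j))) => //.
  by apply: measurable_fun_pair; exact: measurable_tnth.
have [j' jE|jE] := unliftP ord0 j; last by move: ij; rewrite jE ltn0.
have [i' iE|iE] := unliftP ord0 i.
  have ij' : (i' < j')%N by move: ij; rewrite iE jE !lift0.
  apply: aeW => t; rewrite -[RHS](IH i' j')//; congr (power_measure mu n _).
  by apply/seteqP; split => s /=; rewrite iE jE !tnthS.
have /(null_xsectionP _ _ mA) := A0; apply: filterS => t At0.
rewrite -[RHS](null_tnth j' (measurable_xsection t mA) At0).
congr (power_measure mu n _); rewrite xsectionE.
by apply/seteqP; split => s /=; rewrite iE jE tnth0 tnthS.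
Qed.

(** Maps of the complete bipartite graph with colour classes given by [c] into [E]. They also send
    the edges of every graph properly coloured by [c] into [E], up to orientation. [X] and [Y] are
    parameters because they shrink in the induction below. *)
Definition bicliques n (c : 'I_n -> bool) (X Y : set T) (E : set (T * T)) :
    set (n.-tuple T) :=
  [set s | (forall i, if c i then X (tnth s i) else Y (tnth s i)) /\
           forall i j, c i -> ~~ c j -> E (tnth s i, tnth s j)].

Lemma measurable_bicliques n (c : 'I_n -> bool) X Y E :
  measurable X -> measurable Y -> measurable E ->
  measurable (bicliques c X Y E).
Proof.
move=> mX mY mE.
rewrite (_ : bicliques c X Y E =
  (\bigcap_(i in [set: 'I_n])
     (@tnth n T)^~ i @^-1` (if c i then X else Y)) `&`
  (\bigcap_(p in [set p : 'I_n * 'I_n | c p.1 && ~~ c p.2])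
     (fun s : n.-tuple T => (tnth s p.1, tnth s p.2)) @^-1` E)); last first.
  apply/seteqP; split=> s [s1 s2]; split.
  - by move=> i _ /=; have := s1 i; case: ifP.
  - by move=> [i j] /= /andP[]; exact: s2.
  - by move=> i; have /= := s1 i I; case: ifP.
  - by move=> i j ci cj; apply: (s2 (i, j)); rewrite /= ci.
apply: measurableI; apply: fin_bigcap_measurable.
- exact: finite_finset.
- move=> i _; apply: measurable_preimageT; first exact: measurable_tnth.
  by case: ifP.
- exact: finite_finset.
- move=> p _; apply: measurable_preimageT => //.
  by apply: measurable_fun_pair; exact: measurable_tnth.
Qed.

(* Peeling off a first vertex [t] coloured [X] turns bicliques for [X], [Y] into
   bicliques for [X] and the neighbours of [t] in [Y]. *)
Lemma null_bicliques n (c : 'I_n -> bool) X Y E :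
  measurable X -> measurable Y -> measurable E ->
  power_measure mu n (bicliques c X Y E) = 0%E ->
  (mu \x mu)%E (X `*` Y `&` E) = 0%E.
Proof.
move=> + + mE; elim: n c X Y => [c X Y _ _|n IH c X Y mX mY].
  (* The empty tuple is a biclique and has mass 1, so the hypothesis is absurd in dimension 0. *)
  rewrite (_ : bicliques _ _ _ _ = setT); last first.
    by apply/seteqP; split => // s _; split => -[].
  rewrite /= diracT => /eqP; rewrite onee_eq0//.
have mB := measurable_bicliques c mX mY mE.
move=> /(power_null_consP mB) B0.
have mXYE : measurable (X `*` Y `&` E).
  by apply: measurableI => //; exact: measurableX.
pose c' i := c (lift ord0 i).
have [c0|/negP/negP c0] := boolP (c ord0).
- apply: null_duplicate1 => //; move: B0; apply: filterS => t B0.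
  have [Xt|nXt] := pselect (X t); last first.
    rewrite (_ : [set p | _] = set0) ?measure0//.
    by apply/seteqP; split => // p [_ [[/nXt]]].
  have mYt : measurable (Y `&` xsection E t).
    by apply: measurableI => //; exact: measurable_xsection.
  have := IH c' X (Y `&` xsection E t) mX mYt.
  rewrite (_ : X `*` _ `&` E =
      [set p | (X `*` Y `&` E) p /\ (X `*` Y `&` E) (t, p.2)]); last first.
    apply/seteqP; split => -[x y] /=.
      by move=> [[Xx [Yy /xsectionP Ety]] Exy].
    by move=> [[[Xx Yy] Exy] [_ Ety]]; do ?split => //; exact/xsectionP.
  (* Prefixing t to a biclique for the shrunken [Y] gives a biclique for [X] and [Y]. *)
  apply; apply/eqP; rewrite -measure_le0 -{}B0; apply: le_measure.
  + by rewrite inE; exact: measurable_bicliques.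
  + by rewrite inE; exact: measurable_cons_section.
  + move=> s [s1 s2]; split.
      move=> i; have [j ->|->] := unliftP ord0 i; last by rewrite tnth0 c0.
      by rewrite tnthS; have := s1 j; rewrite /c'; case: ifP => // _ [].
    move=> i j; have [i' ->|->] := unliftP ord0 i;
      have [j' ->|->] := unliftP ord0 j; rewrite ?c0 ?tnthS ?tnth0//.
      exact: s2.
    by move=> _ cj; have := s1 j'; rewrite /c' (negbTE cj) => -[_ /xsectionP].
(* Dually, a first vertex t coloured [Y] shrinks [X] to its neighbours of t. *)
- apply: null_duplicate2 => //; move: B0; apply: filterS => t B0.
  have [Yt|nYt] := pselect (Y t); last first.
    rewrite (_ : [set p | _] = set0) ?measure0//.
    by apply/seteqP; split => // p [_ [[_ /nYt]]].
  have mXt : measurable (X `&` ysection E t).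
    by apply: measurableI => //; exact: measurable_ysection.
  have := IH c' (X `&` ysection E t) Y mXt mY.
  rewrite (_ : _ `*` Y `&` E =
      [set p | (X `*` Y `&` E) p /\ (X `*` Y `&` E) (p.1, t)]); last first.
    apply/seteqP; split => -[x y] /=.
      by move=> [[[Xx /ysectionP Ext] Yy] Exy].
    by move=> [[[Xx Yy] Exy] [_ Ext]]; do ?split => //; exact/ysectionP.
  apply; apply/eqP; rewrite -measure_le0 -{}B0; apply: le_measure.
  + by rewrite inE; exact: measurable_bicliques.
  + by rewrite inE; exact: measurable_cons_section.
  + move=> s [s1 s2]; split.
      move=> i; have [j ->|->] := unliftP ord0 i.
        by rewrite tnthS; have := s1 j; rewrite /c'; case: ifP => // _ [].
      by rewrite tnth0 (negbTE c0).
    move=> i j; have [i' ->|->] := unliftP ord0 i;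
      have [j' ->|->] := unliftP ord0 j; rewrite ?(negbTE c0) ?tnthS ?tnth0//.
      exact: s2.
    by move=> ci _; have := s1 i'; rewrite /c' ci => -[_ /ysectionP].
Qed.

End power_null.

(** * The unit square and the unit cube *)

Lemma measurable_unit_square (R : realType) : measurable (unit_square R).
Proof. exact: measurableX. Qed.

Lemma measurable_unit_cube (R : realType) n : measurable (unit_cube R n).
Proof.
rewrite (_ : unit_cube R n =
    \bigcap_(i in [set: 'I_n]) (@tnth n R)^~ i @^-1` `[0, 1]); last first.
  by apply/seteqP; split => [x x01 i _|x x01 i]; [exact: x01|exact: (x01 i I)].
apply: fin_bigcap_measurable; first exact: finite_finset.
by move=> i _; apply: measurable_preimageT => //; exact: measurable_tnth.
Qed.

Lemma lebesgue_power_unit_cube (R : realType) n :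
  lebesgue_power R n (unit_cube R n) = 1%E.
Proof.
elim: n => [|n IH].
  rewrite (_ : unit_cube R 0 = setT); first by rewrite /lebesgue_power/= diracT.
  by apply/seteqP; split => // x _ [].
rewrite /lebesgue_power power_measureS.
rewrite (_ : _ @^-1` _ = `[0, 1] `*` unit_cube R n); last first.
  apply/seteqP; split => [[t s] /= ts01|[t s] [/= t01 s01] i].
    split => [|i]; first by have := ts01 ord0; rewrite tnth0.
    by have := ts01 (lift ord0 i); rewrite tnthS.
  have [j ->|->] := unliftP ord0 i; last by rewrite tnth0.
  by rewrite tnthS; exact: s01.
rewrite product_measure1E//; last exact: measurable_unit_cube.
rewrite -[X in (_ * X)%E]/(lebesgue_power R n (unit_cube R n)) IH.
rewrite mule1; apply: etrans (lebesgue_measure_itv `[0, 1]) _.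
by rewrite /= lte01 sube0.
Qed.

(** * Edge weights and homomorphism densities of a graphon *)

Section graphon.
Context (R : realType) (W : R -> R -> R).
Hypothesis gW : graphon W.

Lemma graphon_ge0 x y : x \in `[0, 1] -> y \in `[0, 1] -> 0 <= W x y.
Proof. by have [_ _ W01] := gW => xI yI; have /itvP-> := W01 x y xI yI. Qed.

Lemma graphon_le1 x y : x \in `[0, 1] -> y \in `[0, 1] -> W x y <= 1.
Proof. by have [_ _ W01] := gW => xI yI; have /itvP-> := W01 x y xI yI. Qed.

Definition fractional_pairs : set (R * R) :=
  unit_square R `&` [set p | W p.1 p.2 \in `]0, 1[].

Lemma measurable_fractional_pairs : measurable fractional_pairs.
Proof.
have [mW _ _] := gW.
exact: (mW (@measurable_unit_square R) [set` `]0, 1[] (measurable_itv _)).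
Qed.

Lemma null_random_free :
  (lebesgue_measure \x lebesgue_measure)%E fractional_pairs = 0%E ->
  random_free W.
Proof.
move/(null_aeP (lebesgue_measure \x lebesgue_measure)%E
  measurable_fractional_pairs).
apply: filterS => p nEp p01.
have [p1 p2] := p01.
have := graphon_ge0 p1 p2; rewrite le_eqVlt => /predU1P[<-|W0]; first by left.
have := graphon_le1 p1 p2; rewrite le_eqVlt => /predU1P[->|W1]; first by right.
by exfalso; apply: nEp; split => //=; rewrite in_itv/= W0 W1.
Qed.

Section edge_weight.
Variable V : finType.
Implicit Types F : multigraph V.

(** The integrand of [hom_density], in the same form so that the two agree by conversion. *)
Definition edge_weight F (x : #|V|.-tuple R) : R :=
  \prod_(p : V * V | (enum_rank p.1 < enum_rank p.2)%N)
    W (tnth x (enum_rank p.1)) (tnth x (enum_rank p.2)) ^+ mult F p.1 p.2.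

Lemma edge_weight01 F x : unit_cube R #|V| x -> 0 <= edge_weight F x <= 1.
Proof.
move=> x01; apply/andP; split.
  by apply: prodr_ge0 => p _; apply/exprn_ge0/graphon_ge0.
apply: prodr_ile1 => p _; rewrite exprn_ge0 ?graphon_ge0//=.
by rewrite exprn_ile1// ?graphon_ge0 ?graphon_le1.
Qed.

Lemma le_edge_weight F F' x : (forall a b, mult F a b <= mult F' a b)%N ->
  unit_cube R #|V| x -> edge_weight F' x <= edge_weight F x.
Proof.
move=> FF' x01; apply: ler_prod => p _; rewrite exprn_ge0 ?graphon_ge0//=.
by apply: ler_wiXn2l => //; [exact: graphon_ge0|exact: graphon_le1].
Qed.

Lemma measurable_edge_weight F :
  measurable_fun (unit_cube R #|V|) (edge_weight F).
Proof.
have [mW _ _] := gW; rewrite /edge_weight.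
under eq_fun do rewrite -big_filter.
apply: measurable_prod => p _; apply: measurable_funX.
pose pr (x : #|V|.-tuple R) := (tnth x (enum_rank p.1), tnth x (enum_rank p.2)).
apply: (measurable_comp (f := fun q : R * R => W q.1 q.2) (g := pr)
  (@measurable_unit_square R)) => //.
  by move=> _ [x x01 <-]; split; exact: x01.
apply: measurable_funTS.
by apply: measurable_fun_pair; exact: measurable_tnth.
Qed.

Lemma integrable_edge_weight F :
  (lebesgue_power R #|V|).-integrable (unit_cube R #|V|)
    (EFin \o edge_weight F).
Proof.
apply: measurable_bounded_integrable; first exact: measurable_unit_cube.
- by rewrite [X in (X < _)%E](lebesgue_power_unit_cube R #|V|) ltry.
- exact: measurable_edge_weight.
exists 1; split => // M M1 x x01 /=; apply: le_trans (ltW M1).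
by have /andP[f0 f1] := edge_weight01 F x01; rewrite ger0_norm.
Qed.

Lemma le_hom_density F F' : (forall a b, mult F a b <= mult F' a b)%N ->
  hom_density F' W <= hom_density F W.
Proof.
move=> FF'; apply: le_Rintegral.
- exact: measurable_unit_cube.
- exact: integrable_edge_weight.
- exact: integrable_edge_weight.
- by move=> x; exact: le_edge_weight.
Qed.

(** The numbers 0 and 1 equal all their positive powers, so only whether a multiplicity is zero
    matters. *)
Lemma random_free_hom_density F F' : random_free W ->
  (forall a b, (mult F a b == 0) = (mult F' a b == 0))%N ->
  hom_density F W = hom_density F' W.
Proof.
move=> [N [mN N0 WN]] FF'; congr fine; apply: ae_eq_integral.
- exact: measurable_unit_cube.
- apply/measurable_EFinP; exact: measurable_edge_weight.
- apply/measurable_EFinP; exact: measurable_edge_weight.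
pose pr (p : V * V) (x : #|V|.-tuple R) :=
  (tnth x (enum_rank p.1), tnth x (enum_rank p.2)).
(* The null set [N] of bad pairs pulls back to a null set along each of the finitely many pairs of
   coordinates. *)
have : \forall x \ae lebesgue_power R #|V|, forall p : V * V,
    (enum_rank p.1 < enum_rank p.2)%N -> ~ N (pr p x).
  apply: filter_forall => p.
  have [p12|_] := boolP (enum_rank p.1 < enum_rank p.2)%N; last exact: aeW.
  have mpN : measurable (pr p @^-1` N).
    apply: measurable_preimageT => //.
    by apply: measurable_fun_pair; exact: measurable_tnth.
  have /(null_aeP (lebesgue_power R #|V|) mpN) := null_tnth_pair p12 mN N0.
  exact: filterS.
apply: (@filterS _ _ (ae_filter_ringOfSetsType (lebesgue_power R #|V|))).
move=> x xN x01; congr EFin; apply: eq_bigr => p p12.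
have W01 : W (pr p x).1 (pr p x).2 = 0 \/ W (pr p x).1 (pr p x).2 = 1.
  apply: contrapT => nW; apply: (xN p p12); apply: WN => /= sqW; apply: nW.
  by apply: sqW; split; exact: x01.
by case: W01 => /= ->; rewrite ?expr1n// !expr0n FF'.
Qed.

(* On the bicliques of [fractional_pairs], the extra multiplicities of [F']
   strictly decrease the weight. *)
Lemma hom_density_eq_random_free F F' (c : V -> bool) a b :
  (forall a b, mult F a b <= mult F' a b)%N ->
  (0 < mult F a b < mult F' a b)%N ->
  (forall u v, (0 < mult F u v)%N -> c u != c v) ->
  hom_density F W = hom_density F' W -> random_free W.
Proof.
move=> FF' Fab cF eqF; apply: null_random_free.
rewrite [X in product_measure1 _ _ X]
  (_ : _ = `[0, 1] `*` `[0, 1] `&` fractional_pairs); last first.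
  by rewrite setIA setIid.
apply: (null_bicliques (c := fun i : 'I_#|V| => c (enum_val i))) => //.
  exact: measurable_fractional_pairs.
pose mu := lebesgue_power R #|V|.
pose f x := edge_weight F x - edge_weight F' x.
have f0 : \int[mu]_(x in unit_cube R #|V|) f x = 0.
  rewrite RintegralB;
    [|exact: measurable_unit_cube|exact: integrable_edge_weight..].
  by apply/eqP; rewrite subr_eq0; apply/eqP.
have fint : mu.-integrable (unit_cube R #|V|) (EFin \o f).
  rewrite (_ : _ \o f =
    (EFin \o edge_weight F) \- (EFin \o edge_weight F'))%E//.
  by apply: integrableB;
    [exact: measurable_unit_cube|exact: integrable_edge_weight..].
(* [f] is nonnegative with integral 0, hence zero almost everywhere. It remains to see that it is
   positive at every biclique. *)
have {f0} : (\int[mu]_(x in unit_cube R #|V|) `|(f x)%:E| = 0)%E.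
  rewrite -[RHS]/(0%R%:E) -f0 [RHS]fineK; last first.
    apply: integrable_fin_num fint; exact: measurable_unit_cube.
  apply: eq_integral => x; rewrite inE => x01; rewrite gee0_abs//.
  by rewrite lee_fin subr_ge0 le_edge_weight.
move/(ae_eq_integral_abs mu (@measurable_unit_cube _ _)
  (measurable_int _ fint)).
have mB := measurable_bicliques (fun i : 'I_#|V| => c (enum_val i))
  (measurable_itv `[0%R : R, 1%R])
  (measurable_itv `[0%R : R, 1%R]) measurable_fractional_pairs.
move=> f_eq0; apply/(null_aeP mu mB); move: f_eq0.
apply: (@filterS _ _ (ae_filter_ringOfSetsType mu)) => x fx0 [x01 xE].
have {}x01 : unit_cube R #|V| x by move=> i; have := x01 i; case: ifP.
have [_ symW _] := gW.
pose w (p : V * V) := W (tnth x (enum_rank p.1)) (tnth x (enum_rank p.2)).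
(* Bicliques control only the pairs ordered by colour; the symmetry of [W] gives the other
   orientation. *)
have Wpos u v : (0 < mult F u v)%N -> w (u, v) \in `]0, 1[.
  move=> /cF; have [cu|cu] := boolP (c u); have [cv|cv] := boolP (c v) => //= _.
    by have [] := xE (enum_rank u) (enum_rank v); rewrite /= ?enum_rankK.
  rewrite /w symW ?x01//.
  by have [] := xE (enum_rank v) (enum_rank u); rewrite /= ?enum_rankK.
have Fpos p : 0 < w p ^+ mult F p.1 p.2.
  have [/Wpos|] := ltnP 0 (mult F p.1 p.2); last first.
    by rewrite leqn0 => /eqP ->; rewrite expr0 ltr01.
  by rewrite in_itv/= => /andP[W0 _]; exact: exprn_gt0.
(* The product runs over pairs of increasing rank, so a and b may have to be swapped. *)
have [p [pr0 Fp]] : exists p : V * V, (enum_rank p.1 < enum_rank p.2)%N /\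
   (0 < mult F p.1 p.2 < mult F' p.1 p.2)%N.
  have [ab|ba|/val_inj/enum_rank_inj ab] := ltngtP (enum_rank a) (enum_rank b).
  - by exists (a, b).
  - by exists (b, a); rewrite /= (mult_sym F) (mult_sym F').
  - by move: Fab; rewrite ab !mult_loopless.
have := fx0 x01; apply/eqP; rewrite gt_eqF// lte_fin subr_gt0.
(* The factor at [p] is strictly smaller for [F']. The other factors have product [P] for [F'] and
   [Q] for [F], with [P <= Q] and [Q] positive. *)
rewrite /edge_weight (bigD1 p)//= [ltRHS](bigD1 p)//=.
set P := \prod_(_ | _) _; set Q := \prod_(_ | _) _.
have Q0 : 0 < Q by apply: prodr_gt0 => q _; exact: Fpos.
have PQ : P <= Q.
  apply: ler_prod => q _; rewrite exprn_ge0 ?graphon_ge0//=.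
  by apply: ler_wiXn2l => //; [exact: graphon_ge0|exact: graphon_le1].
apply: (le_lt_trans (y := w p ^+ mult F' p.1 p.2 * Q)).
  by apply: ler_wpM2l => //; rewrite exprn_ge0// graphon_ge0.
have /andP[/Wpos + FF'p] := Fp; rewrite in_itv/= => /andP[W0 W1].
by rewrite ltr_pM2r// ltr_iXn2l.
Qed.
End edge_weight.
End graphon.

(** * Edge joins and the vanishing of the variance *)

Lemma weak_join_mult (V : finType) (H : sgraph V) (e f : oedge H) p q :
  mult (weak_join e f) p q =
  image_edge (join_inl f) p q || image_edge (join_inr e f) p q.
Proof. by []. Qed.

Lemma strong_join_mult (V : finType) (H : sgraph V) (e f : oedge H) p q :
  mult (strong_join e f) p q =
  (image_edge (join_inl f) p q + image_edge (join_inr e f) p q)%N.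
Proof. by []. Qed.

Theorem theorem4p3 (R : realType) (W : R -> R -> R) (V : finType)
    (H : sgraph V) :
  graphon W ->
  (exists a b : V, H a b) ->
  bipartite H ->
  0 < hom_density H W ->
  sigma2 H W = 0 <-> random_free W.
Proof.
move=> gW [a [b Hab]] [A HA] _.
have le_join (e f : oedge H) p q :
    (mult (weak_join e f) p q <= mult (strong_join e f) p q)%N.
  by rewrite weak_join_mult strong_join_mult; do 2 case: (image_edge _ _ _).
have aut_neq0 : (2 * #|graph_aut H|%:R ^+ 2)^-1 != 0 :> R.
  rewrite invr_eq0 mulf_neq0 ?expf_neq0 ?pnatr_eq0 -?lt0n//.
  by apply/card_gt0P; exists 1%g; rewrite inE; apply/forallP => u;
    apply/forallP => v; rewrite !perm1.
split=> [/eqP|Wrf]; last first.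
  rewrite /sigma2 big1 ?mulr0// => e _; rewrite big1// => f _.
  apply/eqP; rewrite subr_eq0; apply/eqP.
  apply: (random_free_hom_density gW Wrf) => p q.
  by rewrite weak_join_mult strong_join_mult; do 2 case: (image_edge _ _ _).
rewrite mulf_eq0 (negbTE aut_neq0) /= => /eqP sum0.
pose e : oedge H := exist (fun p : V * V => H p.1 p.2) (a, b) Hab.
have term_ge0 (f g : oedge H) : 0 <= hom_density (weak_join f g) W -
                        hom_density (strong_join f g) W.
  by rewrite subr_ge0; exact: (le_hom_density gW (le_join f g)).
(* A vanishing sum of nonnegative terms has only zero terms; this is applied to the outer sum, then
   to the inner one. *)
have e0 := psumr_eq0P (fun f _ => sumr_ge0 _ (fun g _ => term_ge0 f g)) sum0
  (i := e) isT.
have /eqP := psumr_eq0P (fun g _ => term_ge0 e g) e0 (i := e) isT.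
(* In the join along [e] and [e], each glued vertex comes from the same vertex of [H] in both
   copies, so the two-colouring [A] of [H] carries over to the join. *)
rewrite subr_eq0 => /eqP; pose c (v : join_vertex e) :=
  match v with inl u => u \in A | inr w => val w \in A end.
have c_inr v : c (join_inr e e v) = (v \in A).
  rewrite /join_inr; case: insubP => [w _ <-//|].
  by rewrite negb_and !negbK; have [->|_] //= := eqVneq v a; move/eqP=> ->.
(* The glued edge has multiplicity 1 in the weak join and 2 in the strong one. *)
apply: (hom_density_eq_random_free gW (c := c) (a := inl a) (b := inl b)) => //.
  rewrite weak_join_mult strong_join_mult.
  have -> : image_edge (join_inl e) (inl a) (inl b).
    by apply/existsP; exists a; apply/existsP; exists b; rewrite Hab !eqxx.
  have -> // : image_edge (join_inr e e) (inl a) (inl b).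
  apply/existsP; exists a; apply/existsP; exists b; rewrite Hab /join_inr.
  (* [join_inr] tests for the first endpoint first, so b reaches the branch [inl b] only because it
     differs from a. *)
  have ba : b != a by apply: contraTneq (Hab) => ->; rewrite adj_irrefl.
  by rewrite !insubF /= ?eqxx ?andbF// (negbTE ba) !eqxx.
move=> u v; rewrite weak_join_mult lt0b => /orP[] /existsP[x /existsP[y]];
  case/and3P=> xy /eqP<- /eqP<-; last by rewrite !c_inr; exact: HA.
exact: HA.
Qed.
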